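(* Let $k\geqslant2$. The $\overline{\mathbb{F}_q}$-vector space $H^0(\mathbb{P}^1_{\mathbb{F}_q},\Omega^k((k-1)D))$ has dimension $N=k(q-1)-q$, and is spanned by Kurihara differentials.
   Context: $q$ is an odd prime power. $D=\sum_{x\in\mathbb{P}^1(\mathbb{F}_q)}(x)$, and $H^0(\mathbb{P}^1_{\mathbb{F}_q},\Omega^k((k-1)D))$ denotes the $\overline{\mathbb{F}_q}$-vector space of rational $k$-forms $g(z)(\mathrm{d}z)^k$, $g\in\overline{\mathbb{F}_q}(z)$, on the projective line that have poles of order at most $k-1$ at the points of $\mathbb{P}^1(\mathbb{F}_q)$ and are regular elsewhere. For distinct $\alpha,\beta\in\mathbb{P}^1(\mathbb{F}_q)$, $s(z;\alpha,\beta)=\left(\frac1{z-\beta}-\frac1{z-\alpha}\right)\mathrm{d}z$, with $\frac1{z-\infty}=0$. A Kurihara differential is a $k$-form $\prod_{i=1}^rs(z;\alpha_i,\beta_i)^{k_i}$ with $r\geqslant2$, $k_i\geqslant1$, $\sum_{i=1}^rk_i=k$, $\alpha_i,\beta_i\in\mathbb{P}^1(\mathbb{F}_q)$, $\alpha_i\neq\beta_i$, and $\bigcap_{i=1}^r\{\alpha_i,\beta_i\}=\emptyset$. *)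

(* Defs.v *)
From HB Require Import structures.
From mathcomp Require Import all_boot all_order all_algebra.

Set Implicit Arguments.
Unset Strict Implicit.
Unset Printing Implicit Defensive.

Import GRing.Theory.
Local Open Scope ring_scope.

(* [P1 K] is the set of K-points of the projective line, in the
   coordinate z: [Some a] is the point z = a and [None] is the point at
   infinity. *)
Notation P1 := option.

Notation ratfun K := {fraction {poly K}}.

(* The rational k-form g(z) (dz)^k is represented by its coefficient g.  The
   degree k is kept in the type because it determines the behaviour of the form
   at infinity; the product of a k-form and an l-form is the (k+l)-form whose
   coefficient is the product of the coefficients. *)
Definition kform (K : fieldType) (k : nat) : Type := ratfun K.

HB.instance Definition _ (K : fieldType) (k : nat) :=
  GRing.Zmodule.on (kform K k).

Section KForm.
Variables (K : fieldType) (k : nat).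

Definition coef (w : kform K k) : ratfun K := w.

Definition scale_kform (c : K) (w : kform K k) : kform K k :=
  tofrac c%:P * coef w.

Fact scale_kformA a b w :
  scale_kform a (scale_kform b w) = scale_kform (a * b) w.
Proof. by rewrite /scale_kform /coef polyCM rmorphM mulrA. Qed.

Fact scale_kform1 : left_id 1 scale_kform.
Proof. by move=> w; rewrite /scale_kform /coef polyC1 rmorph1 mul1r. Qed.

Fact scale_kformDr : right_distributive scale_kform +%R.
Proof. by move=> a u v; rewrite /scale_kform /coef mulrDr. Qed.

Fact scale_kformDl w : {morph scale_kform^~ w : a b / a + b}.
Proof. by move=> a b; rewrite /scale_kform /coef polyCD rmorphD mulrDl. Qed.

HB.instance Definition _ := GRing.Zmodule_isLmodule.Build K (kform K k)
  scale_kformA scale_kform1 scale_kformDr scale_kformDl.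

End KForm.

Section LocalBehaviour.
Variable K : fieldType.

(* Membership of g in the local ring of P^1 at P. At infinity, p/q is regular
   exactly when deg p <= deg q. *)
Definition regular_at (P : P1 K) (g : ratfun K) : Prop :=
  exists p q : {poly K},
    match P with
    | Some a => q.[a] != 0
    | None => q != 0 /\ (size p <= size q)%N
    end /\ g = tofrac p / tofrac q.

Definition local_param (P : P1 K) : ratfun K :=
  match P with
  | Some a => tofrac ('X - a%:P)
  | None => (tofrac 'X)^-1
  end.

(* The function c such that dz = c dt, where t is the local parameter at P.
   At infinity t = 1/z and dz = - t^-2 dt = - z^2 dt. *)
Definition dz_over_dt (P : P1 K) : ratfun K :=
  match P with
  | Some _ => 1
  | None => - tofrac 'X ^+ 2
  end.

(* Writing w = h (dt)^k near P, t^m h is regular at P. *)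
Definition pole_order_le (k : nat) (w : kform K k) (P : P1 K) (m : nat) : Prop :=
  regular_at P (local_param P ^+ m * (coef w * dz_over_dt P ^+ k)).

(* H^0(P^1, Omega^k(E)) for an effective divisor E; K is meant to be
   algebraically closed, so that the closed points are the K-points. *)
Definition H0 (k : nat) (E : P1 K -> nat) (w : kform K k) : Prop :=
  forall P : P1 K, pole_order_le w P (E P).

(* 1 / (z - P), with 1 / (z - infinity) = 0. *)
Definition inv_z_minus (P : P1 K) : ratfun K :=
  match P with
  | Some a => (tofrac ('X - a%:P))^-1
  | None => 0
  end.

Definition s_form (alpha beta : P1 K) : kform K 1 :=
  inv_z_minus beta - inv_z_minus alpha.

End LocalBehaviour.

Section Rational.
Variables (F : finFieldType) (K : fieldType) (iota : {rmorphism F -> K}).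

Definition P1_map (x : P1 F) : P1 K := omap iota x.

(* The divisor D, the sum of the F-points of P^1, as a multiplicity function. *)
Definition divD (P : P1 K) : nat := (\sum_(x : P1 F) (P1_map x == P))%N.

Definition kurihara (k : nat) (w : kform K k) : Prop :=
  exists (r : nat) (kk : 'I_r -> nat) (alpha beta : 'I_r -> P1 F),
    [/\ (2 <= r)%N,
        (forall i, (1 <= kk i)%N) /\ (\sum_(i < r) kk i = k)%N,
        (forall i, alpha i != beta i),
        (\bigcap_(i < r) [set alpha i; beta i])%SET = set0 &
        coef w =
        \prod_(i < r) coef (s_form (P1_map (alpha i)) (P1_map (beta i))) ^+ kk i].

End Rational.

Section LinearAlgebra.
Variables (K : fieldType) (V : lmodType K).

(* U is a linear subspace of V with a basis of n vectors. *)
Definition has_dim (U : V -> Prop) (n : nat) : Prop :=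
  exists b : 'I_n -> V,
    (forall c : 'I_n -> K, \sum_i c i *: b i = 0 -> forall i, c i = 0) /\
    (forall v, U v <-> exists c : 'I_n -> K, v = \sum_i c i *: b i).

Definition in_span (S : V -> Prop) (v : V) : Prop :=
  exists (n : nat) (c : 'I_n -> K) (s : 'I_n -> V),
    (forall i, S (s i)) /\ v = \sum_i c i *: s i.

End LinearAlgebra.

(* Main.v *)
(* Let P be the product of the z - x, x in F_q. The regular forms are the
   p / P^(k-1) with deg p <= q(k-1) - k - 1 (the bound is the condition at
   infinity), which gives the dimension.

   For the spanning, consider more generally p / prod_(x <- s) (z - x) with s a
   multiset in which every point occurs at most k - 1 times and
   deg p <= |s| - k - 1. If p != 0 then |s| > k; given a in s, choose a
   sub-multiset s1 of s with k + 1 elements containing all the copies of a.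
   A multiple of 1 / prod_(x <- s1) (z - x), which is proportional to a
   Kurihara differential, has the same leading term at a, and subtracting it
   removes one copy of a from s; conclude by induction on |s|. *)
Require Import Defs.
From HB Require Import structures.
From mathcomp Require Import all_boot all_order all_algebra.
From mathcomp Require Import ring zify.

Set Implicit Arguments.
Unset Strict Implicit.
Unset Printing Implicit Defensive.

Import GRing.Theory.

(** * Local rings of the projective line *)

Section Regular.
Local Open Scope ring_scope.
Variable K : fieldType.
Implicit Types (P : P1 K) (f g : ratfun K) (p q : {poly K}).

Lemma ratfun_coprime f :
  exists p q, [/\ q != 0, coprimep p q & f = tofrac p / tofrac q].
Proof.
elim/quotW: f => r; set n := (frac r).1; set d := (frac r).2.
have d0 : d != 0 := denom_ratioP r.
have rE : (\pi_(ratfun K) r = tofrac n / tofrac d)%qT.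
  apply: (canRL (mulfK _)); first by rewrite tofrac_eq0.
  (* In the quotient, the product of [r] by [d] and the fraction [n] are compared by
     cross-multiplying representatives. *)
  unlock FracField.tofrac; rewrite -[LHS]FracField.pi_mul; apply/eqP.
  rewrite FracField.equivf_def /FracField.equivf /FracField.mulf /=.
  by rewrite !numden_Ratio ?mulf_neq0 ?oner_neq0 // !mulr1 mulrC.
have g0 : gcdp n d != 0 by rewrite gcdp_eq0 negb_and d0 orbT.
have dd := divpK (dvdp_gcdr n d); have nn := divpK (dvdp_gcdl n d).
exists (n %/ gcdp n d), (d %/ gcdp n d); split.
- by apply: contraNneq d0 => d00; rewrite -dd d00 mul0r.
- by apply: coprimep_div_gcd; rewrite d0 orbT.
move: g0 dd nn; set g := gcdp n d => g0; set d' := d %/ g => dd.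
set n' := n %/ g => nn; rewrite [LHS]rE -nn -dd !tofracM -mulf_div.
by rewrite divff ?mulr1 // tofrac_eq0.
Qed.

Lemma regular_atM P f g :
  regular_at P f -> regular_at P g -> regular_at P (f * g).
Proof.
move=> [p1 [q1 [h1 ->]]] [p2 [q2 [h2 ->]]].
exists (p1 * p2), (q1 * q2); split; last by rewrite !tofracM mulf_div.
case: P h1 h2 => [a|] h1 h2; first by rewrite hornerM mulf_neq0.
case: h1 h2 => [q10 s1] [q20 s2]; split; first by rewrite mulf_neq0.
have [->|p10] := eqVneq p1 0; first by rewrite mul0r size_poly0.
have [->|p20] := eqVneq p2 0; first by rewrite mulr0 size_poly0.
by rewrite !size_mul // -!subn1 leq_sub2r // leq_add.
Qed.

Lemma regular_atD P f g :
  regular_at P f -> regular_at P g -> regular_at P (f + g).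
Proof.
move=> [p1 [q1 [h1 ->]]] [p2 [q2 [h2 ->]]].
have nz a q : q.[a] != 0 -> q != 0.
  by apply: contraNneq => ->; rewrite horner0.
have q10 : q1 != 0 by case: P h1 {h2} => [a /nz|[]].
have q20 : q2 != 0 by case: P h2 {h1} => [a /nz|[]].
exists (p1 * q2 + p2 * q1), (q1 * q2); split; last first.
  by rewrite tofracD !tofracM addf_div ?tofrac_eq0.
case: P h1 h2 {nz} => [a|] h1 h2; first by rewrite hornerM mulf_neq0.
case: h1 h2 => [_ s1] [_ s2]; split; first by rewrite mulf_neq0.
apply: leq_trans (size_polyD _ _) _; rewrite geq_max [q1 * q2]mulrC.
apply/andP; split; last rewrite [q2 * q1]mulrC.
  have [->|p10] := eqVneq p1 0; first by rewrite mul0r size_poly0.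
  by rewrite !size_mul // -!subn1 leq_sub2r // addnC leq_add2l.
have [->|p20] := eqVneq p2 0; first by rewrite mul0r size_poly0.
by rewrite !size_mul // -!subn1 leq_sub2r // addnC leq_add2l.
Qed.

Lemma regular_atC P c : regular_at P (tofrac c%:P).
Proof.
exists c%:P, 1; split; last by rewrite tofrac1 divr1.
case: P => [a|]; first by rewrite hornerC oner_neq0.
by rewrite oner_neq0 size_poly1 size_polyC_leq1.
Qed.

Lemma regular_at0 P : regular_at P 0.
Proof. by rewrite -tofrac0 -polyC0; apply: regular_atC. Qed.

Lemma regular_at1 P : regular_at P 1.
Proof. by rewrite -tofrac1 -polyC1; apply: regular_atC. Qed.

Lemma regular_atN P f : regular_at P f -> regular_at P (- f).
Proof.
move=> rf; rewrite -mulN1r -tofrac1 -tofracN -polyCN.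
exact/regular_atM/rf/regular_atC.
Qed.

Lemma regular_atX P f n : regular_at P f -> regular_at P (f ^+ n).
Proof.
move=> rf; elim: n => [|n IHn]; first exact: regular_at1.
by rewrite exprS; apply: regular_atM.
Qed.

Lemma regular_at_prod P I (r : seq I) (Q : pred I) (f : I -> ratfun K) :
  (forall i, Q i -> regular_at P (f i)) ->
  regular_at P (\prod_(i <- r | Q i) f i).
Proof.
by move=> rf; apply: big_ind => //; [apply: regular_at1 | apply: regular_atM].
Qed.

Lemma regular_at_poly a p : regular_at (Some a) (tofrac p).
Proof. by exists p, 1; rewrite hornerC oner_neq0 tofrac1 divr1. Qed.

Lemma regular_at_local_param P : regular_at P (local_param P).
Proof.
case: P => [a|] /=; first exact: regular_at_poly.
exists 1, 'X; rewrite polyX_eq0 size_poly1 size_polyX; split=> //.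
by rewrite tofrac1 div1r.
Qed.

End Regular.

(** In lowest terms a root of the denominator is a genuine pole, and over an algebraically closed
    field a denominator without roots is constant. *)
Lemma regular_polynomial (K : closedFieldType) (f : ratfun K) :
  (forall a, regular_at (Some a) f) -> exists p, f = tofrac p.
Proof.
move=> regf; have [p [d [d0 cpd fE]]] := ratfun_coprime f.
have /eqP/size_poly1P[c c0 dE] : size d = 1%N.
  apply/eqP/negPn/negP => /closed_rootP[a da].
  have [p1 [q1 [q1a]]] := regf a; rewrite fE => /eqP.
  rewrite eqr_div ?tofrac_eq0 //; last first.
    by apply: contraNneq q1a => ->; rewrite horner0.
  rewrite -!tofracM tofrac_eq => /eqP/(congr1 (horner^~ a))/eqP.
  rewrite !hornerM (rootP da) mulr0 mulf_eq0 (negPf q1a) orbF.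
  by apply/negP/(coprimep_root _ da); rewrite coprimep_sym.
exists (c^-1 *: p)%R; rewrite fE dE.
apply: (canLR (mulfK _)); first by rewrite tofrac_eq0 polyC_eq0.
by rewrite -tofracM mulrC mul_polyC scalerA divff ?scale1r.
Qed.

(** * Forms with poles along the rational points *)

Section Poles.
Local Open Scope ring_scope.

(** Cross-multiplication shows that the degree difference does not depend on the fraction chosen, so
    the existential in [regular_at] can be tested on any given one. *)
Lemma regular_at_infty (K : fieldType) (p q : {poly K}) :
  q != 0 -> regular_at None (tofrac p / tofrac q) <-> (size p <= size q)%N.
Proof.
move=> q0; split=> [[p' [q' [[q'0 le_p'q']]]]|]; last by exists p, q.
move/eqP; rewrite eqr_div ?tofrac_eq0 // -!tofracM tofrac_eq => /eqP pq'.
have [->|p0] := eqVneq p 0; first by rewrite size_poly0.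
have p'0 : p' != 0.
  by apply: contraNneq (mulf_neq0 p0 q'0) => p'0; rewrite pq' p'0 mul0r.
have := congr1 (fun r : {poly K} => size r) pq'; rewrite !size_mul //.
move: p0 q0 p'0 q'0; rewrite -!size_poly_gt0.
move: (size p) (size q) (size p') (size q') le_p'q' => a b c d; lia.
Qed.

Variables (F : finFieldType) (K : fieldType) (iota : {rmorphism F -> K}).
Implicit Types (x : F) (s : seq F).

Lemma P1_map_inj : injective (P1_map iota).
Proof. by move=> [x|] [y|] //= [/fmorph_inj ->]. Qed.

Lemma divD_map (x : P1 F) : divD iota (P1_map iota x) = 1%N.
Proof.
rewrite /divD (bigD1 x) //= eqxx big1 // => y yx.
by rewrite (inj_eq P1_map_inj) (negPf yx).
Qed.

Lemma divD_notin (P : P1 K) :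
  (forall x : P1 F, P1_map iota x != P) -> divD iota P = 0%N.
Proof. by move=> xP; rewrite /divD big1 // => x _; rewrite (negPf (xP x)). Qed.

Definition root_poly s : {poly K} := \prod_(x <- s) ('X - (iota x)%:P).

Lemma root_poly_neq0 s : root_poly s != 0.
Proof. exact/monic_neq0/monic_prod_XsubC. Qed.

Lemma size_root_poly s : size (root_poly s) = (size s).+1.
Proof. exact: size_prod_XsubC. Qed.

Lemma root_poly_cat s t : root_poly (s ++ t) = root_poly s * root_poly t.
Proof. exact: big_cat. Qed.

Lemma root_poly_cons x s :
  root_poly (x :: s) = ('X - (iota x)%:P) * root_poly s.
Proof. exact: big_cons. Qed.

Lemma perm_root_poly s t : perm_eq s t -> root_poly s = root_poly t.
Proof. exact: perm_big. Qed.

Lemma root_root_poly s a : root (root_poly s) a = (a \in map iota s).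
Proof.
rewrite /root_poly -(big_map iota xpredT (fun a => 'X - a%:P)).
exact: root_prod_XsubC.
Qed.

(** The points of F are simple roots of P and there are no others, so the order of P at any [a] is
    the multiplicity of [a] in D. *)
Lemma root_poly_enum a : exists2 R : {poly K}, R.[a] != 0 &
  root_poly (enum F) = ('X - a%:P) ^+ divD iota (Some a) * R.
Proof.
have [/mapP[x _ ->]|aF] := boolP (a \in map iota (enum F)); last first.
  exists (root_poly (enum F)); first by rewrite -rootE root_root_poly.
  rewrite divD_notin ?mul1r // => -[x|] //=.
  by apply: contraNneq aF => -[<-]; rewrite map_f ?mem_enum.
exists (root_poly (rem x (enum F))); last first.
  rewrite -[Some _]/(P1_map iota (Some x)) divD_map -root_poly_cons.
  by apply/perm_root_poly/perm_to_rem; rewrite mem_enum.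
rewrite -rootE root_root_poly mem_map; last exact: fmorph_inj.
by rewrite mem_rem_uniqF ?enum_uniq.
Qed.

Variable k : nat.

Definition over_poles (p : {poly K}) : kform K k :=
  tofrac p / tofrac (root_poly (enum F) ^+ k.-1).

Lemma over_poles_sum n (c : 'I_n -> K) (p : 'I_n -> {poly K}) :
  over_poles (\sum_i c i *: p i) = \sum_i c i *: over_poles (p i).
Proof.
rewrite /over_poles rmorph_sum mulr_suml; apply: eq_bigr => i _.
by rewrite -mul_polyC rmorphM -mulrA.
Qed.

Lemma over_poles_eq0 p : over_poles p = 0 -> p = 0.
Proof.
move/eqP; rewrite mulf_eq0 invr_eq0 !tofrac_eq0 expf_eq0.
by rewrite (negPf (root_poly_neq0 _)) andbF orbF => /eqP.
Qed.

(** In the parameter t = 1/z, the function to test is, up to sign, z^(k+1) p / P^(k-1). It is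
    regular when deg p + k + 1 <= q(k-1), and q(k-1) - k = k(q-1) - q. *)
Lemma over_poles_infty p : (0 < k)%N ->
  pole_order_le (over_poles p) None k.-1 <->
  (size p <= k * (#|F| - 1) - #|F|)%N.
Proof.
move=> k0; have P0 : root_poly (enum F) ^+ k.-1 != 0.
  by rewrite expf_neq0 ?root_poly_neq0.
have X0 : tofrac 'X != 0 :> ratfun K by rewrite tofrac_eq0 polyX_eq0.
rewrite /pole_order_le /=.
have -> : (tofrac 'X)^-1 ^+ k.-1 *
      (coef (over_poles p) * (- tofrac 'X ^+ 2) ^+ k) =
    tofrac ((-1) ^+ k *: ('X^(k.+1) * p)) /
      tofrac (root_poly (enum F) ^+ k.-1).
  rewrite /coef /over_poles -mul_polyC polyC_exp polyCN polyC1.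
  rewrite !tofracM !tofracXn tofracN tofrac1.
  set X := tofrac 'X; set p' := tofrac p; set d := _^-1.
  rewrite exprVn; apply: (canLR (mulKf _)); first by rewrite expf_neq0.
  rewrite [(- _) ^+ k]exprNn -exprM.
  have -> : (2 * k = k.-1 + k.+1)%N by lia.
  by rewrite exprD; ring.
rewrite regular_at_infty //.
have -> : size (root_poly (enum F) ^+ k.-1) = (#|F| * k.-1).+1.
  by rewrite -[LHS](prednK _) ?size_poly_gt0 // size_exp size_root_poly -cardE.
(* The zero polynomial satisfies both sides; otherwise [size p] is positive, so the truncated
   subtraction in the bound does no harm. *)
have [->|p0] := eqVneq p 0; first by rewrite mulr0 scaler0 size_poly0; split.
rewrite size_scale ?signr_eq0 // mulrC size_mulXn //.
move: p0; rewrite -size_poly_gt0; move: (size p) #|F| => m n m0.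
by rewrite mulnBr muln1 -subn1 mulnBr muln1 [(n * k)%N]mulnC; split; lia.
Qed.

End Poles.

(** * Explicit description of the global sections *)

Section Global.
Local Open Scope ring_scope.

(** Multiplying by P^(k-1) clears all finite poles, which leaves a polynomial; the condition at
    infinity then bounds its degree. *)
Lemma H0P (F : finFieldType) (K : closedFieldType) (iota : {rmorphism F -> K}) k
    (w : kform K k) : (0 < k)%N ->
  H0 (fun P => (k - 1) * divD iota P)%N w <->
  exists2 p : {poly K}, (size p <= k * (#|F| - 1) - #|F|)%N &
    w = over_poles iota k p.
Proof.
rewrite subn1 => k0; split=> [Hw | [p szp ->] [a|]]; last 1 first.
- by rewrite (divD_map iota None) muln1; apply/over_poles_infty.
- have [p Dp] : exists p,
      (w : ratfun K) * tofrac (root_poly iota (enum F) ^+ k.-1) = tofrac p.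
    apply: regular_polynomial => a; have [R Ra ->] := root_poly_enum iota a.
    have := Hw (Some a); rewrite /pole_order_le /= expr1n mulr1 => wa.
    rewrite exprMn -exprM tofracM !tofracXn mulnC mulrA [coef w * _]mulrC.
    apply: regular_atM wa _; apply/regular_atX/regular_at_poly.
  have wE : w = over_poles iota k p.
    by rewrite /over_poles -Dp mulfK // tofrac_eq0 expf_neq0 ?root_poly_neq0.
  exists p => //; apply/(over_poles_infty iota) => //; rewrite -wE.
  by have := Hw None; rewrite (divD_map iota None) muln1.
(* Conversely, at a finite point the power of the local parameter cancels exactly the part of
   P^(k-1) vanishing there, and leaves R^(k-1) as denominator. *)
have [R Ra RE] := root_poly_enum iota a.
rewrite /pole_order_le /= expr1n mulr1 /over_poles RE; exists p, (R ^+ k.-1).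
rewrite horner_exp expf_neq0 //; split=> //.
have Xa0 : (tofrac ('X - a%:P)) ^+ (k.-1 * divD iota (Some a)) != 0 :> ratfun K.
  by rewrite expf_neq0 // tofrac_eq0 polyXsubC_eq0.
rewrite exprMn -exprM tofracM tofracXn [(divD _ _ * _)%N]mulnC /coef invfM.
by rewrite mulrCA mulVKf.
Qed.

End Global.

(** * Poles of the forms s(z; alpha, beta) *)

Section SForm.
Local Open Scope ring_scope.

Lemma subVr (L : fieldType) (u v : L) : u != 0 -> v != 0 ->
  v^-1 - u^-1 = (u - v) * (u * v)^-1.
Proof. by move=> u0 v0; field; rewrite u0 v0. Qed.

Variable K : fieldType.

Lemma s_form_finite (a b : K) :
  s_form (Some a) (Some b) =
  tofrac (b - a)%:P * (tofrac ('X - a%:P) * tofrac ('X - b%:P))^-1 :> ratfun K.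
Proof.
rewrite /s_form /= subVr ?tofrac_eq0 ?polyXsubC_eq0 //; congr (_ * _).
by rewrite -tofracB polyCB opprB addrC subrKA.
Qed.

(** The boolean exponent treats at once a simple pole at [a] and the absence of a pole. *)
Lemma regular_inv_z_minus (a : K) (P : P1 K) (m : bool) :
  (P == Some a) ==> m ->
  regular_at (Some a) (tofrac ('X - a%:P) ^+ m * inv_z_minus P).
Proof.
have [-> /= ->|Pa _] := eqVneq P (Some a).
  by rewrite mulfV ?tofrac_eq0 ?polyXsubC_eq0 //; apply: regular_at1.
apply: regular_atM; first exact/regular_atX/regular_at_poly.
case: P Pa => [b|] ba /=; last exact: regular_at0.
exists 1, ('X - b%:P); rewrite tofrac1 div1r; split => //.
by rewrite hornerXsubC subr_eq0; apply: contraNneq ba => ->.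
Qed.

(** At infinity dz contributes -z^2. If both points are finite, the coefficient decays like z^-2 and
    compensates it; if one is infinite, the coefficient decays like z^-1 and a simple pole
    remains. *)
Lemma s_form_pole (alpha beta P : P1 K) : alpha != beta ->
  regular_at P (local_param P ^+ (P \in [:: alpha; beta])
                * (coef (s_form alpha beta) * dz_over_dt P)).
Proof.
move=> ab; case: P => [a|].
  rewrite mulr1 /coef /s_form /= mulrBr; apply: regular_atD.
    apply: regular_inv_z_minus; rewrite !inE eq_sym.
    by case: eqP; rewrite ?orbT.
  by apply/regular_atN/regular_inv_z_minus; rewrite !inE eq_sym; case: eqP.
have X0 : tofrac 'X != 0 :> ratfun K by rewrite tofrac_eq0 polyX_eq0.
have XM (c : K) : regular_at None (tofrac 'X / tofrac ('X - c%:P)).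
  by apply/regular_at_infty; rewrite ?polyXsubC_eq0 // size_polyX size_XsubC.
have XsubC0 (c : K) : tofrac ('X - c%:P) != 0.
  by rewrite tofrac_eq0 polyXsubC_eq0.
rewrite /= !inE; case: alpha beta ab => [a|] [b|] //= ab.
- rewrite mul1r /coef s_form_finite mulrN invfM expr2 -mulrA mulrACA.
  apply/regular_atN/regular_atM; first exact: regular_atC.
  by apply: regular_atM; rewrite mulrC; apply: XM.
- rewrite /coef /s_form sub0r mulrNN /= expr2 mulrC -!mulrA mulfV // mulr1.
  by rewrite mulrC; apply: XM.
rewrite /coef /s_form subr0 mulrN /= expr2 mulrN mulrC -!mulrA mulfV //.
by rewrite mulr1 mulrC; apply/regular_atN/XM.
Qed.

End SForm.

(** * Closure properties of linear spans *)

Section InSpan.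
Local Open Scope ring_scope.
Variables (K : fieldType) (V : lmodType K) (S : V -> Prop).
Implicit Types (v w : V).

Lemma in_span0 : in_span S 0.
Proof.
exists 0%N, (fun=> 0), (fun=> 0); rewrite big_ord0.
by split=> // -[].
Qed.

Lemma in_spanD v w : in_span S v -> in_span S w -> in_span S (v + w).
Proof.
move=> [m [c [s [Ss ->]]]] [n [d [t [St ->]]]].
exists (m + n)%N, (fun i => match split i with inl j => c j | inr j => d j end),
  (fun i => match split i with inl j => s j | inr j => t j end); split.
  by move=> i; case: (split i).
rewrite big_split_ord /=; congr (_ + _); apply: eq_bigr => i _.
  by rewrite (unsplitK (inl i)).
by rewrite (unsplitK (inr i)).
Qed.

Lemma in_spanZ a v : in_span S v -> in_span S (a *: v).
Proof.
move=> [m [c [s [Ss ->]]]]; exists m, (fun i => a * c i), s; split=> //.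
by rewrite scaler_sumr; apply: eq_bigr => i _; rewrite scalerA.
Qed.

Lemma in_span_mem v : S v -> in_span S v.
Proof.
by move=> Sv; exists 1%N, (fun=> 1), (fun=> v); rewrite big_ord1 scale1r.
Qed.

End InSpan.

(** * Kurihara differentials as sections and as generators *)

Section Span.
Local Open Scope ring_scope.
Variables (F : finFieldType) (K : fieldType) (iota : {rmorphism F -> K}).

(** The pole order at P is at most the sum of the k_i over the pairs containing P. A rational point
    is missed by some pair, as the intersection is empty, and this pair has k_i >= 1; so the sum is
    at most k - 1. Other points lie in no pair. *)
Lemma kurihara_H0 k (w : kform K k) :
  kurihara iota w -> H0 (fun P => (k - 1) * divD iota P)%N w.
Proof.
move=> [r [kk [alpha [beta [r2 [kk0 sumk] ab capab wE]]]]] P.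
rewrite /pole_order_le wE.
pose m i : nat := P \in [:: P1_map iota (alpha i); P1_map iota (beta i)].
(* [n] is the slack between the order allowed at [P] and the order accounted for by the factors. *)
have [n ->] : exists n, ((k - 1) * divD iota P = n + \sum_i m i * kk i)%N.
  exists ((k - 1) * divD iota P - \sum_i m i * kk i)%N; rewrite subnK //.
  have [/existsP[x /eqP xP]|nP] := boolP [exists x, P1_map iota x == P];
    last first.
    rewrite big1 // => i _; rewrite /m !inE ![P == _]eq_sym.
    by move: nP; rewrite negb_exists => /forallP nP; rewrite !(negPf (nP _)).
  have [i xi] : exists i, x \notin [set alpha i; beta i].
    apply/existsP; apply: contraT; rewrite negb_exists => /forallP xab.
    have : x \in \bigcap_(i < r) [set alpha i; beta i].
      by apply/bigcapP => i _; rewrite -[_ \in _]negbK xab.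
    by rewrite capab inE.
  have mi0 : m i = 0%N.
    apply/eqP; rewrite eqb0 -xP !inE !(inj_eq (@P1_map_inj _ _ iota)).
    by move: xi; rewrite !inE.
  rewrite -{1}xP divD_map muln1 -sumk (bigD1 i) //= mi0 add0n.
  rewrite [(\sum_(j < r) kk j)%N](bigD1 i) //=.
  have le_kk : (\sum_(j | j != i) m j * kk j <= \sum_(j | j != i) kk j)%N.
    by apply: leq_sum => j _; rewrite /m; case: (_ \in _); rewrite ?mul1n.
  have := kk0 i; move: le_kk.
  by move: (\sum_(j | _) _)%N (\sum_(j | _) _)%N => *; lia.
rewrite exprD -mulrA; apply: regular_atM.
  exact/regular_atX/regular_at_local_param.
have -> : local_param P ^+ (\sum_i m i * kk i)
    * ((\prod_i
          coef (s_form (P1_map iota (alpha i)) (P1_map iota (beta i))) ^+ kk i)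
       * dz_over_dt P ^+ k) =
   \prod_i (local_param P ^+ m i * (coef (s_form (P1_map iota (alpha i))
           (P1_map iota (beta i))) * dz_over_dt P)) ^+ kk i.
  rewrite -sumk !expr_sum -!big_split; apply: eq_bigr => i _ /=.
  by rewrite !exprMn exprM.
apply: regular_at_prod => i _; apply/regular_atX/s_form_pole.
by rewrite (inj_eq (@P1_map_inj _ _ iota)).
Qed.

(* A multiset s of k + 1 points in which every point occurs at most k - 1 times
   contains two distinct points u, v; the edge {u, v} together with the edges
   from infinity to the k - 1 other points defines a Kurihara differential. *)
Lemma kurihara_inv_root_poly k (s : seq F) : (1 < k)%N ->
    size s = k.+1 -> (forall x, (count_mem x s < k)%N) ->
  in_span (kurihara iota (k := k)) ((tofrac (root_poly iota s))^-1 : kform K k).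
Proof.
move=> k1 sz_s cnt_s.
case: s sz_s cnt_s => // u s [sz_s] cnt_us.
have /hasP[v vs /= vu] : has (predC1 u) s.
  rewrite has_predC; apply/negP => /all_pred1P us.
  by have := cnt_us u; rewrite /= eqxx us count_nseq /= eqxx sz_s mul1n; lia.
have p_s := perm_to_rem vs; set t := rem v s in p_s.
have sz_t : size t = k.-1 by have := perm_size p_s; rewrite sz_s => ->.
pose alpha (i : 'I_k) : P1 F := if i == 0%N :> nat then Some u else None.
pose beta (i : 'I_k) : P1 F := Some (nth u (v :: t) i).
pose w : kform K k := \prod_(i < k)
  coef (s_form (P1_map iota (alpha i)) (P1_map iota (beta i))) ^+ 1.
pose i0 : 'I_k := Ordinal (ltnW k1).
have Kw : kurihara iota w.
  exists k, (fun=> 1%N), alpha, beta; split=> //.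
  - by split=> //; rewrite sum1_card card_ord.
  - move=> i; rewrite /alpha /beta; have [->|//] := eqVneq (i : nat) 0%N.
    by apply: contraNneq vu => -[->].
  (* A common point lies in {u, v}, hence is finite, so it must equal each of the k - 1 entries of
     [t]; with [u] or [v] this makes k copies in the multiset. *)
  apply/setP => y; rewrite inE; apply/negP => /bigcapP y_ab.
  have [z yz zuv] : exists2 z, y = Some z & z \in [:: u; v].
    have := y_ab i0 isT; rewrite /alpha /beta !inE /=.
    by case/orP => /eqP->; [exists u | exists v]; rewrite // !inE eqxx ?orbT.
  have tz : t = nseq k.-1 z.
    rewrite -sz_t; apply/all_pred1P/(all_nthP u) => j jt.
    have jk : (j.+1 < k)%N by move: jt; rewrite sz_t; lia.
    have := y_ab (Ordinal jk) isT; rewrite yz /alpha /beta !inE /=.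
    by rewrite eq_sym => /eqP[->]; rewrite /= eqxx.
  have := cnt_us z; rewrite /= (permP p_s) /= tz count_nseq /= eqxx mul1n.
  by move: zuv; rewrite !inE => /orP[]/eqP->; rewrite eqxx; lia.
have wE : w =
    iota (v - u) *: ((tofrac (root_poly iota (u :: s)))^-1 : kform K k).
  have u0 : tofrac ('X - (iota u)%:P) != 0 by rewrite tofrac_eq0 polyXsubC_eq0.
  have v0 : tofrac ('X - (iota v)%:P) != 0 by rewrite tofrac_eq0 polyXsubC_eq0.
  (* Each factor contributes 1/(z - b) for its second point b; [c] collects what remains, namely (v
     - u)/(z - u) from the edge {u, v}. *)
  pose c (i : 'I_k) : ratfun K := if i == 0%N :> nat then
    tofrac (iota (v - u))%:P / tofrac ('X - (iota u)%:P) else 1.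
  have -> : w = (\prod_i c i) *
      \prod_(i < k) (tofrac ('X - (iota (nth u (v :: t) i))%:P))^-1 :> ratfun K.
    rewrite -big_split; apply: eq_bigr => i _ /=.
    rewrite /alpha /beta /c expr1; case: (eqVneq (i : nat) 0%N) => [->|_] /=.
      by rewrite /coef s_form_finite -rmorphB invfM mulrA.
    by rewrite /coef /s_form /= subr0 mul1r.
  rewrite (bigD1 i0) //= [\prod_(i | _) c i]big1 ?mulr1; last first.
    move=> i ii0; rewrite /c; case: (eqVneq (i : nat) 0%N) ii0 => // i_0.
    by move=> /eqP[]; apply/val_inj.
  have sz_vt : size (v :: t) = k by rewrite /= sz_t; lia.
  rewrite prodfV -rmorph_prod.
  rewrite (perm_root_poly iota (t := u :: v :: t)) ?perm_cons //.
  rewrite root_poly_cons /root_poly (big_nth u) big_mkord sz_vt tofracM invfM.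
  by rewrite /c /= -mulrA.
have -> : ((tofrac (root_poly iota (u :: s)))^-1 : kform K k)
    = (iota (v - u))^-1 *: w.
  by rewrite wE scalerA mulVf ?scale1r // fmorph_eq0 subr_eq0.
exact/in_spanZ/in_span_mem.
Qed.

(** For nonzero [p], the size condition says that the form has a pole of order at most k - 1 at
    infinity, which matches the bound on multiplicities at finite points. *)
Lemma in_span_root_poly k (s : seq F) (p : {poly K}) : (1 < k)%N ->
    (forall x, (count_mem x s < k)%N) -> p = 0 \/ (size p + k <= size s)%N ->
  in_span (kurihara iota (k := k))
    (tofrac p / tofrac (root_poly iota s) : kform K k).
Proof.
move=> k1; have [n] := ubnP (size s); elim: n => // n IHn in s p *.
rewrite ltnS => le_sn cnt_s [->|szp].
  by rewrite tofrac0 mul0r; apply: in_span0.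
have [->|p0] := eqVneq p 0; first by rewrite tofrac0 mul0r; apply: in_span0.
have lt_ks : (k < size s)%N by move: p0; rewrite -size_poly_gt0; lia.
case: s => // a s in le_sn cnt_s szp lt_ks *.
(* The copies of [a] come first; there are fewer than k of them, so the first k + 1 entries contain
   them all. *)
pose s0 := filter (pred1 a) (a :: s) ++ filter (predC (pred1 a)) (a :: s).
have p_s0 : perm_eq s0 (a :: s) by rewrite perm_filterC.
pose s1 := take k.+1 s0; pose s2 := drop k.+1 s0.
have s0E : s0 = s1 ++ s2 by rewrite cat_take_drop.
have sz_s0 : size s0 = (size s).+1 by rewrite (perm_size p_s0).
have sz_s1 : size s1 = k.+1 by rewrite size_take_min sz_s0; apply/minn_idPl.
have sz_s2 : size s2 = (size s - k)%N by rewrite size_drop sz_s0 subSS.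
have as2 : a \notin s2.
  rewrite /s2 /s0 drop_cat size_filter; case: ltnP => [|_].
    by rewrite ltnNge (leqW (ltnW (cnt_s a))).
  by apply/negP => /mem_drop; rewrite mem_filter /= eqxx.
(* As 1/r(s1) = r(s2)/r(a :: s), with r for [root_poly], subtracting c/r(s1) replaces [p] by p - c
   r(s2); this [c] makes the new numerator vanish at [a]. *)
set c := p.[iota a] / (root_poly iota s2).[iota a].
have r2a : (root_poly iota s2).[iota a] != 0.
  by rewrite -rootE root_root_poly mem_map //; apply: fmorph_inj.
have /factor_theorem[p' p'E] : root (p - c *: root_poly iota s2) (iota a).
  by rewrite rootE !hornerE divfK // subrr.
have X0 x : tofrac ('X - (iota x)%:P) != 0 by rewrite tofrac_eq0 polyXsubC_eq0.
have r0 t : tofrac (root_poly iota t) != 0 by rewrite tofrac_eq0 root_poly_neq0.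
have -> : (tofrac p / tofrac (root_poly iota (a :: s)) : kform K k) =
    (c *: ((tofrac (root_poly iota s1))^-1 : kform K k)
      + tofrac p' / tofrac (root_poly iota s) : kform K k).
  have -> : p = c *: root_poly iota s2 + p' * ('X - (iota a)%:P).
    by rewrite -p'E addrC subrK.
  rewrite -mul_polyC tofracD !tofracM mulrDl; congr (_ + _).
    rewrite -(perm_root_poly _ p_s0) s0E root_poly_cat tofracM.
    by rewrite [X in _ / X]mulrC -mulrA invfM mulVKf.
  rewrite root_poly_cons tofracM -mulrA; congr (_ * _).
  by rewrite invfM mulVKf.
apply: in_spanD.
  apply/in_spanZ/kurihara_inv_root_poly => // x; apply: leq_ltn_trans (cnt_s x).
  by rewrite -(permP p_s0) s0E count_cat leq_addr.
apply: IHn => //.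
  by move=> x; apply: leq_ltn_trans (cnt_s x); rewrite /= leq_addl.
have [->|p'0] := eqVneq p' 0; [by left | right].
(* Both [p] and r(s2) have size at most |s| + 1 - k, and dividing by z - a lowers the bound by one,
   as removing [a] from the multiset requires. *)
have := size_polyD p (- (c *: root_poly iota s2)).
rewrite p'E size_Mmonic ?monicXsubC // size_XsubC addn2 size_polyN /=.
move=> le_p'; rewrite -ltnS -addSn.
apply: leq_trans (leq_add le_p' (leqnn k)) _.
rewrite addn_maxl geq_max szp /=.
apply: leq_trans (leq_add (size_scale_leq _ _) (leqnn _)) _.
by rewrite size_root_poly sz_s2 addSn subnK.
Qed.

End Span.

(** * Dimension and generation of the space of sections *)

Theorem lemma5p1p4 (F : finFieldType) (q : nat) (hq : #|F| = q) (hodd : odd q)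
    (Fbar : closedFieldType) (iota : {rmorphism F -> Fbar})
    (halg : forall x : Fbar, algebraicOver iota x)
    (k : nat) (hk : 2 <= k) :
  let H : kform Fbar k -> Prop := H0 (fun P => (k - 1) * divD iota P) in
  has_dim H (k * (q - 1) - q) /\
  (forall w : kform Fbar k, H w <-> in_span (kurihara iota (k := k)) w).
Proof.
move=> H; rewrite -hq; have k0 := ltnW hk.
have HP w := H0P iota w k0; set N := k * _ - _ in HP *.
have Hsum n (c : 'I_n -> Fbar) (s : 'I_n -> kform Fbar k) :
    (forall i, H (s i)) -> H (\sum_i c i *: s i)%R.
  move=> Hs P; elim/big_ind: _ => [|v w Hv Hw|i _];
    rewrite /pole_order_le /coef.
  - by rewrite mul0r mulr0; apply: regular_at0.
  - by rewrite mulrDl mulrDr; apply: regular_atD; [apply: Hv | apply: Hw].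
  rewrite -mulrA mulrCA; apply: regular_atM; first exact: regular_atC.
  exact: (Hs i P).
split; last first.
  move=> w; split=> [/HP[p szp ->]|[n [c [s [Ks ->]]]]]; last first.
    by apply: Hsum => i; apply: kurihara_H0.
  (* Every point of F with multiplicity k - 1, so that [root_poly iota s] is P^(k-1). *)
  pose s := flatten [seq nseq k.-1 x | x <- enum F].
  have cnt_s x : count_mem x s = k.-1.
    rewrite count_flatten -map_comp sumnE big_map big_enum (bigD1 x) //= big1.
      by rewrite count_nseq /= eqxx mul1n addn0.
    by move=> y yx; rewrite count_nseq /= (negPf yx).
  have sz_s : size s = #|F| * k.-1.
    rewrite size_flatten /shape -map_comp sumnE big_map big_enum /=.
    by under eq_bigr do rewrite size_nseq; rewrite sum_nat_const.
  have sE : root_poly iota s = (root_poly iota (enum F) ^+ k.-1)%R.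
    rewrite /root_poly big_flatten big_map -prodrXl; apply: eq_bigr => x _.
    by rewrite big_nseq iter_mulr_1.
  rewrite /over_poles -sE; apply: in_span_root_poly => // [x|].
    by rewrite cnt_s prednK.
  have [->|] := eqVneq p 0%R; first by left.
  rewrite -size_poly_gt0 sz_s => p_gt0; right.
  move: szp p_gt0; rewrite /N; move: (size p) #|F| => m n szp m0.
  by move: szp; rewrite -subn1 !mulnBr !muln1 [n * k]mulnC; lia.
(* The basis consists of the z^i / P^(k-1) with i < N; the coordinates of a section are the
   coefficients of its numerator. *)
exists (fun i => over_poles iota k 'X^i); split.
  move=> c; rewrite -over_poles_sum => /over_poles_eq0 c0 i.
  have /(congr1 (fun p : {poly Fbar} => p`_i)%R) := c0.
  rewrite coef_sum coef0 (bigD1 i) //= coefZ coefXn eqxx mulr1.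
  rewrite big1 ?addr0 // => j ji.
  by rewrite coefZ coefXn eq_sym (inj_eq val_inj) (negPf ji) mulr0.
move=> w; split=> [/HP[p szp ->]|[c ->]].
  exists (fun i => p`_i)%R; rewrite -over_poles_sum; congr over_poles.
  apply/polyP => i; rewrite -poly_def coef_poly; case: ltnP => // le_Ni.
  by rewrite nth_default // (leq_trans szp).
apply: Hsum => i; apply/HP; exists 'X^i%R => //.
by rewrite size_polyXn.
Qed.
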